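(* The wave closure space $\mathcal{G}$, equipped with the pointwise product $\otimes$, is an infinite divisible abelian torsion group, and there is a group isomorphism $$(\mathcal{G},\otimes)\;\cong\;(\mathbb{Q}/\mathbb{Z},+)\times(\mathbb{Q}/\mathbb{Z},+).$$
   Context: Let $\mathcal{F}(\mathbb{Z},\mathbb{R})$ be the additive group of all functions $\theta:\mathbb{Z}\to\mathbb{R}$ (phase configurations) and let $\mathbb{T}^{\mathbb{Z}}$ be the set of sequences $u:\mathbb{Z}\to\mathbb{C}$ with $|u[m]|=1$ for all $m$. The projection $\pi:\mathcal{F}(\mathbb{Z},\mathbb{R})\to\mathbb{T}^{\mathbb{Z}}$ is $\pi(\theta)[m]=\exp(2\pi i\,\theta[m])$. The pointwise product is $(u\otimes v)[m]=u[m]v[m]$. The primitive phase generators are $\Theta_Z[m]=m$ and $\Theta_{\bar 1}[m]=1$ for all $m\in\mathbb{Z}$. On phase configurations consider the operations: addition $\theta_1+\theta_2$; negation $-\theta$; and, for every integer $n\ge 1$ and every $k\in\{0,\dots,n-1\}$, the $k$-th branch of the $n$-th root, $(\theta^{1/n})_{(k)}[m]=\frac{\theta[m]+k}{n}$. The wave closure space is $\mathcal{G}:=\pi(C)$, where $C$ is the smallest subset of $\mathcal{F}(\mathbb{Z},\mathbb{R})$ containing $\Theta_Z$ and $\Theta_{\bar 1}$ and closed under all these operations. *)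

(* Defs.v *)
From HB Require Import structures.
From mathcomp Require Import all_boot all_order all_algebra.
From mathcomp Require Import ring_quotient archimedean complex.
From mathcomp Require Import all_classical all_reals all_analysis.

Set Implicit Arguments.
Unset Strict Implicit.
Unset Printing Implicit Defensive.

Import Order.TTheory GRing.Theory Num.Theory.

Local Open Scope classical_set_scope.
Local Open Scope ring_scope.
Local Open Scope complex_scope.

Section UnitCircle.
Variable R : realType.

Record circle := Circle { circle_val :> R[i]; _ : `|circle_val| == 1 }.

HB.instance Definition _ := [isSub for circle_val].
HB.instance Definition _ := [Choice of circle by <:].

Implicit Types u v : circle.

Fact circle_norm u : `|val u| = 1.
Proof. by apply/eqP; case: u. Qed.

Fact circle_one_subproof : `|1 : R[i]| == 1.
Proof. by rewrite normr1. Qed.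

Fact circle_mul_subproof u v : `|val u * val v| == 1.
Proof. by rewrite normrM !circle_norm mulr1. Qed.

Fact circle_inv_subproof u : `|(val u)^-1| == 1.
Proof. by rewrite normfV circle_norm invr1. Qed.

Definition circle_one := Circle circle_one_subproof.
Definition circle_mul u v := Circle (circle_mul_subproof u v).
Definition circle_inv u := Circle (circle_inv_subproof u).

Fact circle_neq0 u : val u != 0.
Proof. by rewrite -normr_gt0 circle_norm ltr01. Qed.

Fact circle_mulA : associative circle_mul.
Proof. by move=> u v w; apply: val_inj; rewrite /= mulrA. Qed.

Fact circle_mul1 : left_id circle_one circle_mul.
Proof. by move=> u; apply: val_inj; rewrite /= mul1r. Qed.

Fact circle_mulr1 : right_id circle_one circle_mul.
Proof. by move=> u; apply: val_inj; rewrite /= mulr1. Qed.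

Fact circle_mulV : left_inverse circle_one circle_inv circle_mul.
Proof. by move=> u; apply: val_inj; rewrite /= mulVf // circle_neq0. Qed.

Fact circle_mulrV : right_inverse circle_one circle_inv circle_mul.
Proof. by move=> u; apply: val_inj; rewrite /= mulfV // circle_neq0. Qed.

HB.instance Definition _ := isGroup.Build circle
  circle_mulA circle_mul1 circle_mulr1 circle_mulV circle_mulrV.

End UnitCircle.

Section CircleSequences.
Variable R : realType.

(* A named type of its own, so that [*%g] on it resolves to the pointwise
   product below. *)
Definition circle_seq := int -> circle R.

HB.instance Definition _ := Choice.copy circle_seq (int -> circle R).

Implicit Types u v : circle_seq.

Definition seq_one : circle_seq := fun=> 1%g.
Definition seq_mul u v : circle_seq := fun m => (u m * v m)%g.
Definition seq_inv u : circle_seq := fun m => (u m)^-1%g.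

Fact seq_mulA : associative seq_mul.
Proof. by move=> u v w; apply/funext => m; rewrite /seq_mul mulgA. Qed.

Fact seq_mul1 : left_id seq_one seq_mul.
Proof. by move=> u; apply/funext => m; rewrite /seq_mul mul1g. Qed.

Fact seq_mulr1 : right_id seq_one seq_mul.
Proof. by move=> u; apply/funext => m; rewrite /seq_mul mulg1. Qed.

Fact seq_mulV : left_inverse seq_one seq_inv seq_mul.
Proof. by move=> u; apply/funext => m; rewrite /seq_mul mulVg. Qed.

Fact seq_mulrV : right_inverse seq_one seq_inv seq_mul.
Proof. by move=> u; apply/funext => m; rewrite /seq_mul mulgV. Qed.

HB.instance Definition _ := isGroup.Build circle_seq
  seq_mulA seq_mul1 seq_mulr1 seq_mulV seq_mulrV.

End CircleSequences.

Section WaveClosure.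
Variable R : realType.

(* The complex exponential, absent from the library, through
   e^(x + iy) = e^x (cos y + i sin y). *)
Definition cexp (z : R[i]) : R[i] :=
  (expR (complex.Re z) * cos (complex.Im z)) +i*
  (expR (complex.Re z) * sin (complex.Im z)).

Fact cexp_circle_subproof (t : R) : `|cexp ((2 * pi * t) *i)| == 1.
Proof.
by rewrite normc_def /= expR0 !mul1r cos2Dsin2 sqrtr1.
Qed.

Definition projection (theta : int -> R) : circle_seq R :=
  fun m => Circle (cexp_circle_subproof (theta m)).

Definition Theta_Z : int -> R := fun m => m%:~R.
Definition Theta_1 : int -> R := fun=> 1.

Definition phase_root (n k : nat) (theta : int -> R) : int -> R :=
  fun m => (theta m + k%:R) / n%:R.

Definition phase_closed (A : set (int -> R)) : Prop :=
  [/\ forall theta1 theta2, A theta1 -> A theta2 -> A (theta1 + theta2),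
      forall theta, A theta -> A (- theta)
    & forall n k theta, (0 < n)%N -> (k < n)%N ->
        A theta -> A (phase_root n k theta)].

Definition phases : set (int -> R) :=
  smallest phase_closed [set Theta_Z; Theta_1].

Definition wave_closure : set (circle_seq R) := projection @` phases.

End WaveClosure.

Arguments Theta_Z : clear implicits.
Arguments Theta_1 : clear implicits.
Arguments phases : clear implicits.
Arguments wave_closure : clear implicits.

Section GroupProperties.
Variables (gT : groupType) (G : set gT).

Definition divisible_in : Prop :=
  {in G, forall u, forall n : nat, (0 < n)%N ->
    exists2 v, v \in G & (v ^+ n)%g = u}.

Definition torsion_in : Prop :=
  {in G, forall u, exists2 n : nat, (0 < n)%N & (u ^+ n)%g = 1%g}.

End GroupProperties.

(* [Num.int_num_subdef] is the membership predicate underlying [Num.int], the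
   integers inside an archimedean domain; the library attaches the subgroup
   structure to it rather than to the qualifier. *)
Definition int_in_rat : zmodClosed rat :=
  GRing.ZmodClosed.clone rat (@Num.int_num_subdef rat) _.

Definition rat_mod_int : zmodType := {ideal_quot int_in_rat}.

(* Main.v *)
Require Import Defs.
From mathcomp Require Import all_boot all_order all_algebra.
From mathcomp Require Import generic_quotient ring_quotient.
From mathcomp Require Import all_classical all_reals all_analysis.
From mathcomp Require Import archimedean complex ring lra.
Import Order.TTheory GRing.Theory Num.Theory.
Local Open Scope classical_set_scope.
Local Open Scope ring_scope.

(** The phases generated by [Theta_Z] and [Theta_1] are exactly the affine
functions [m |-> a m + b] with rational [a] and [b]: these are stable under the
three operations (for the roots, by [phase_root_affine]), and
conversely the zeroth branches of the roots divide by every positive integer,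
so that a closed set is stable under rational scaling ([phase_closed_ratZ]) and
contains every rational combination of the two generators ([phasesE]).

The group [wave_closure R] is therefore the image of the group [rat * rat] under
the morphism [wave] that sends [(a, b)] to the sequence
[m |-> exp (2 pi i (a m + b))].  Such a sequence is trivial exactly when
[a m + b] is an integer for all [m], that is, by taking [m = 0] and [m = 1],
when [a] and [b] are both integers ([wave_eq1]); this rests on the fact that
[exp (2 pi i t) = 1] only at integral [t] ([circle_exp_eq1]).  The kernel of
[wave] being the square of the integers inside [rat * rat], the first
isomorphism theorem identifies its image with the square of Q/Z.  An
image of the divisible group [rat * rat] is divisible; it is torsion because
the product of the denominators of [a] and [b] sends [(a, b)] into the kernel;
and it is infinite because the waves of the pairs [(0, 1 / (n + 1))] are
pairwise distinct. *)

(** * Rational numbers modulo the integers *)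

Lemma mulr_denq_int (a : rat) : a *+ `|denq a| \is a Num.int.
Proof.
rewrite -[X in X *+ _]divq_num_den -mulr_natr natr_absz ger0_norm ?denq_ge0 //.
by rewrite divfK ?intr_int // intr_eq0 denq_neq0.
Qed.

Definition rat_class (a : rat) : rat_mod_int := (\pi_(rat_mod_int) a)%qT.

Lemma rat_classD a b : rat_class (a + b) = rat_class a + rat_class b.
Proof. exact: raddfD. Qed.

Lemma rat_class_eq a b : rat_class a = rat_class b <-> a - b \is a Num.int.
Proof.
rewrite (_ : (_ \is a Num.int) = (a == b %[mod rat_mod_int])%qT).
  by split=> /eqP.
by rewrite -Quotient.idealrBE.
Qed.

Definition class_pair (p : rat * rat) : rat_mod_int * rat_mod_int :=
  (rat_class p.1, rat_class p.2).

(** * The exponential from the line to the unit circle *)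

Section Phases.
Variable R : realType.
Implicit Types (s t : R) (theta : int -> R) (p q : rat * rat).

Definition circle_exp t : circle R := Circle (cexp_circle_subproof t).

Lemma val_circle_exp t :
  val (circle_exp t) = (cos (2 * pi * t) +i* sin (2 * pi * t))%C.
Proof. by rewrite /circle_exp /cexp /= expR0 !mul1r. Qed.

Lemma circle_expD s t : circle_exp (s + t) = (circle_exp s * circle_exp t)%g.
Proof.
apply: val_inj.
have -> : val (circle_exp s * circle_exp t)%g =
  val (circle_exp s) * val (circle_exp t) by [].
rewrite !val_circle_exp mulrDr cosD sinD.
by apply/eqP; rewrite eq_complex /= eqxx addrC eqxx.
Qed.

Lemma circle_exp1 : circle_exp 1 = 1%g.
Proof.
apply: val_inj; rewrite val_circle_exp mulr1.
have -> : 2 * pi = pi *+ 2 :> R by rewrite mulr_natl.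
by rewrite cos2pi sin2pi.
Qed.

Lemma circle_exp0 : circle_exp 0 = 1%g.
Proof. by apply: val_inj; rewrite val_circle_exp mulr0 cos0 sin0. Qed.

Lemma circle_expN t : circle_exp (- t) = (circle_exp t)^-1%g.
Proof.
apply: (@mulgI _ (circle_exp t)).
by rewrite mulgV -circle_expD subrr circle_exp0.
Qed.

Lemma circle_exp_int (n : int) : circle_exp n%:~R = 1%g.
Proof.
have exp_nat (k : nat) : circle_exp k%:R = 1%g.
  elim: k => [|k IHk]; first exact: circle_exp0.
  by rewrite -natr1 circle_expD IHk circle_exp1 mulg1.
by case: n => k; rewrite ?NegzE ?mulrNz ?circle_expN exp_nat ?invg1.
Qed.

(** If [r] is the fractional part of [t], then [cos (2 pi r)] is equal to
[1 - 2 sin (pi r) ^ 2], and for [0 <= r < 1] the factor [sin (pi r)] vanishes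
only at [r = 0]. *)
Lemma circle_exp_eq1 t : (circle_exp t == 1%g) = (t \is a Num.int).
Proof.
apply/eqP/idP => [|/intrP[n ->]]; last exact: circle_exp_int.
rewrite -[t](subrK (Num.floor t)%:~R) circle_expD circle_exp_int mulg1.
have /andP[] := floor_itv t; set r := t - _; rewrite -subr_ge0 => r0.
rewrite intrD mulr1z addrC -ltrBlDr => r1 /(congr1 val).
rewrite val_circle_exp => -[] cos1 _.
suff -> : r = 0 by rewrite add0r intr_int.
apply: contra_eq cos1 => rN0.
have rgt0 : 0 < r by rewrite lt0r rN0.
have : 0 < sin (pi * r).
  by rewrite sin_gt0_pi// mulr_gt0 ?pi_gt0//= gtr_pMr ?pi_gt0.
move=> /(fun h => exprn_gt0 2 h) s0.
have -> : 2 * pi * r = (pi * r) *+ 2 by ring.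
have := cos2Dsin2 (pi * r); rewrite cos_mulr2n; lra.
Qed.

(** * Phases are the rational affine functions *)

Lemma projectionE theta m : projection theta m = circle_exp (theta m).
Proof. by []. Qed.

Lemma projectionD theta1 theta2 :
  projection (theta1 + theta2) = (projection theta1 * projection theta2)%g.
Proof. by apply/funext => m; rewrite projectionE circle_expD. Qed.

Definition affine_phase p : int -> R := fun m => ratr p.1 * m%:~R + ratr p.2.

Lemma affine_phaseD p q :
  affine_phase (p + q) = affine_phase p + affine_phase q.
Proof.
by apply/funext => m; rewrite /affine_phase !rmorphD /= mulrDl addrACA.
Qed.

Lemma affine_phaseN p : affine_phase (- p) = - affine_phase p.
Proof.
by apply/funext => m; rewrite /affine_phase !rmorphN /= mulNr -opprD.
Qed.

(** The branch number [k] of the root only shifts the constant term, which is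
why all branches stay inside the rational affine phases. *)
Lemma phase_root_affine (n k : nat) p :
  phase_root n k (affine_phase p) =
  affine_phase (p.1 / n%:R, (p.2 + k%:R) / n%:R).
Proof.
apply/funext => m; rewrite /phase_root /affine_phase /=.
rewrite !fmorph_div !rmorphD /= !ratr_nat; ring.
Qed.

Lemma phase_closed0 (A : set (int -> R)) theta :
  phase_closed A -> A theta -> A 0.
Proof. by move=> [AD AN _] At; rewrite -(subrr theta); apply/AD/AN. Qed.

(** Sums and opposites give the integral multiples of [theta]; the branch of
index 0 of the root of order [denq a] then divides by the denominator. *)
Lemma phase_closed_ratZ (A : set (int -> R)) (a : rat) theta :
  phase_closed A -> A theta -> A (fun m => ratr a * theta m).
Proof.
move=> A_closed At; have [AD AN AR] := A_closed.
have A_mul (k : nat) : A (fun m => k%:R * theta m).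
  elim: k => [|k IHk].
    by under eq_fun do rewrite mul0r; apply: phase_closed0 At.
  under eq_fun do rewrite -natr1 mulrDl mul1r.
  exact: (AD _ _ IHk At).
have A_int (k : int) : A (fun m => k%:~R * theta m).
  case: k => k; first exact: A_mul.
  under eq_fun do rewrite NegzE mulrNz mulNr.
  exact: (AN _ (A_mul _)).
have d_gt0 : (0 < `|denq a|)%N by rewrite absz_gt0 denq_neq0.
suff -> : (fun m => ratr a * theta m) =
  phase_root `|denq a| 0 (fun m => (numq a)%:~R * theta m) by exact: AR.
apply/funext => m.
by rewrite /phase_root addr0 mulrAC /ratr natr_absz ger0_norm ?denq_ge0.
Qed.

Lemma phasesE : phases R = range affine_phase.
Proof.
apply/seteqP; split=> [|_ [p _ <-] A /= [A_closed A_gen]].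
  apply: smallest_sub => [|theta [->|->]].
  - split=> [_ _ [p _ <-] [q _ <-]|_ [p _ <-]|n k _ _ _ [p _ <-]].
    + by exists (p + q) => //; rewrite affine_phaseD.
    + by exists (- p) => //; rewrite affine_phaseN.
    + by rewrite phase_root_affine; eexists.
  - exists (1, 0) => //; apply/funext => m.
    by rewrite /affine_phase /= rmorph1 rmorph0 mul1r addr0.
  - exists (0, 1) => //; apply/funext => m.
    by rewrite /affine_phase /= rmorph1 rmorph0 mul0r add0r.
have [AD _ _] := A_closed.
have -> : affine_phase p = (fun m => ratr p.1 * Theta_Z R m) +
                           (fun m => ratr p.2 * Theta_1 R m).
  by apply/funext => m; rewrite /affine_phase -[X in _ + X]mulr1.
by apply: AD; apply: phase_closed_ratZ => //; apply: A_gen; [left|right].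
Qed.

(** * Waves and their kernel *)

Definition wave p : circle_seq R := projection (affine_phase p).

Lemma wave_closureE : wave_closure R = range wave.
Proof. by rewrite /wave_closure phasesE image_comp. Qed.

Lemma mem_wave p : wave p \in wave_closure R.
Proof. by rewrite wave_closureE; apply/mem_set; exists p. Qed.

Lemma wave_closureP u : reflect (exists p, u = wave p) (u \in wave_closure R).
Proof.
rewrite wave_closureE; apply: (iffP idP) => [/set_mem[p _ <-]|[p ->]].
  by exists p.
by apply/mem_set; exists p.
Qed.

Lemma waveD p q : wave (p + q) = (wave p * wave q)%g.
Proof. by rewrite /wave affine_phaseD projectionD. Qed.

Lemma wave0 : wave 0 = 1%g.
Proof. by apply: (@mulgI _ (wave 0)); rewrite -waveD addr0 mulg1. Qed.

Lemma waveN p : wave (- p) = (wave p)^-1%g.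
Proof. by apply: (@mulgI _ (wave p)); rewrite -waveD subrr mulgV wave0. Qed.

Lemma waveMn p n : wave (p *+ n) = (wave p ^+ n)%g.
Proof. by elim: n => [|n IHn]; rewrite ?wave0 // mulrS waveD IHn expgS. Qed.

Lemma ratr_int_num (a : rat) : ((ratr a : R) \is a Num.int) = (a \is a Num.int).
Proof.
apply/intrP/intrP => -[n an]; exists n.
  by apply: (fmorph_inj (ratr : rat -> R)); rewrite /= an ratr_int.
by rewrite an ratr_int.
Qed.

(** Integrality of [a m + b] at [m = 0] says that [b] is an integer, and the
difference with its value at [m = 1] says the same of [a]. *)
Lemma wave_eq1 p :
  wave p = 1%g <-> p.1 \is a Num.int /\ p.2 \is a Num.int.
Proof.
split=> [w1|[p1 p2]]; last first.
  apply/funext => m; apply/eqP; rewrite [wave p m]projectionE circle_exp_eq1.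
  apply: rpredD; last by rewrite ratr_int_num.
  by apply: rpredM; [rewrite ratr_int_num|apply: intr_int].
have int_phase m : affine_phase p m \is a Num.int.
  by rewrite -circle_exp_eq1; apply/eqP; rewrite -projectionE -/(wave p) w1.
have p2 := int_phase 0; rewrite /affine_phase mulr0z mulr0 add0r in p2.
have := rpredB (int_phase 1) p2; rewrite /affine_phase mulr1z mulr1 addrK.
by rewrite !ratr_int_num in p2 *.
Qed.

(** The isomorphism theorem for [wave]: it makes the map sending the wave of
[(a, b)] to the classes of [a] and [b] both well defined and injective. *)
Lemma wave_eq p q : wave p = wave q <-> class_pair p = class_pair q.
Proof.
have -> : wave p = wave q <-> wave (p - q) = 1%g.
  rewrite waveD waveN; split=> [->|pq]; first by rewrite mulgV.
  by rewrite -[wave p](mulgVK (wave q)) pq mul1g.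
rewrite wave_eq1 -!rat_class_eq /class_pair.
by split=> [[-> ->]|[]].
Qed.

End Phases.

(** * The structure of the wave closure *)

Theorem theorem4p1 (R : realType) :
  [/\ group_closed (mem (wave_closure R)),
      {in wave_closure R &, forall u v, commute u v},
      infinite_set (wave_closure R),
      divisible_in (wave_closure R)
    & torsion_in (wave_closure R)] /\
  exists f : circle_seq R -> rat_mod_int * rat_mod_int,
    set_bij (wave_closure R) setT f /\
    {in wave_closure R &, forall u v, f (u * v)%g = f u + f v}.
Proof.
split; first split.
- split; first by rewrite -(wave0 R) mem_wave.
  move=> _ _ /wave_closureP[p ->] /wave_closureP[q ->].
  by rewrite -waveN -waveD mem_wave.
- move=> _ _ /wave_closureP[p ->] /wave_closureP[q ->].
  by rewrite /commute -!waveD addrC.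
- pose w (n : nat) := wave R (0, n.+1%:R^-1).
  have w_inj : injective w.
    move=> m n /wave_eq[/rat_class_eq]; set d := _ - _ => d_int.
    (* Both inverses lie in ]0, 1], so an integral difference is 0. *)
    have [d0|dN0] := eqVneq d 0.
      move/eqP: d0; rewrite subr_eq0 => /eqP/invr_inj/eqP.
      by rewrite eqr_nat => /eqP[].
    have inv_itv k : 0 < k.+1%:R^-1 :> rat /\ k.+1%:R^-1 <= 1 :> rat.
      by rewrite invr_gt0 ltr0Sn invf_le1 ?ltr0Sn // ler1n.
    have := norm_intr_ge1 d_int dN0; rewrite leNgt => /negP[].
    have [m_gt0 m_le1] := inv_itv m; have [n_gt0 n_le1] := inv_itv n.
    have dist_lt1 (x y : rat) : 0 < x -> x <= 1 -> 0 < y -> y <= 1 ->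
        `|x - y| < 1.
      by move=> *; rewrite ltr_norml; apply/andP; split; lra.
    exact: dist_lt1.
  move=> /(finite_preimage (in2W w_inj)); rewrite (_ : _ @^-1` _ = setT).
    exact: infinite_nat.
  by apply/seteqP; split=> // n _; apply/set_mem/mem_wave.
- move=> _ /wave_closureP[p ->] n n_gt0.
  exists (wave R (p.1 / n%:R, p.2 / n%:R)); first exact: mem_wave.
  rewrite -waveMn; congr wave; case: p => a b.
  have divMn (c : rat) : (c / n%:R) *+ n = c.
    by rewrite -mulr_natr divfK // pnatr_eq0 -lt0n.
  by apply: injective_projections; rewrite raddfMn divMn.
- move=> _ /wave_closureP[p ->].
  exists (`|denq p.1| * `|denq p.2|)%N.
    by rewrite muln_gt0 !absz_gt0 !denq_neq0.
  rewrite -waveMn wave_eq1; split; last rewrite mulnC.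
    by rewrite raddfMn mulrnA rpredMn // mulr_denq_int.
  by rewrite raddfMn mulrnA rpredMn // mulr_denq_int.
(* A wave determines its coefficients only modulo integers: [f] chooses some,
   and [wave_eq] makes their classes independent of the choice. *)
pose f u := class_pair (xget 0 [set p | u = wave R p]).
have f_wave p : f (wave R p) = class_pair p.
  by rewrite /f; case: xgetP => [q _ /wave_eq ->|/(_ p)[]].
exists f; split; last first.
  move=> _ _ /wave_closureP[p ->] /wave_closureP[q ->].
  by rewrite -waveD !f_wave /class_pair !rat_classD.
split=> // [_ _ /wave_closureP[p ->] /wave_closureP[q ->]|[x y] _].
  by rewrite !f_wave => /wave_eq.
exists (wave R (repr x, repr y)); first exact/set_mem/mem_wave.
by rewrite f_wave /class_pair /rat_class !reprK.
Qed.
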